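(* Let $P,Q\in\mathbb R^{m\times n}$ and $c\in\mathbb R^m$. Suppose that $m\le n$ and $\mu_C>0$. Then, for every $\alpha>0$, every $\alpha$-projected stationary point belongs to $\mathcal S$. If, in addition, $\{y^k\}$ is generated from some $y^0\in\mathcal C$ by the safeguarded projected-gradient algorithm described in the context, there are constants $\underline\alpha,\overline\alpha$ with $0<\underline\alpha\le\alpha_k\le\overline\alpha<1/L$ for all $k$, and $\{y^k\}$ is bounded, then $$\Phi(y^k)\to0,\qquad \operatorname{dist}(y^k,\mathcal S)\to0,$$ and every accumulation point of $\{y^k\}$ belongs to $\mathcal S$.
   Context: Norms are Euclidean (vectors) and spectral (matrices); inequalities are componentwise and $\odot$ is the componentwise product. Let $P,Q\in\mathbb R^{m\times n}$, $c\in\mathbb R^m$, and $\mathcal C:=\{(u,v)\in\mathbb R^n\times\mathbb R^n: u\ge0,\ v\ge0,\ u\odot v=0\}$. For $y=(u,v)\in\mathbb R^{2n}$ set $H:=[P,\ Q]$, $r(y):=Hy-c=Pu+Qv-c$, $\Phi(y):=\tfrac12\|Hy-c\|^2$, so $\nabla\Phi(y)=H^\top(Hy-c)$, and $L:=\|H\|^2$. Let $\mathcal S:=\{y\in\mathcal C: r(y)=0\}$. For a nonempty closed set $\Omega$, $\Pi_\Omega(y):=\operatorname{argmin}_{z\in\Omega}\|y-z\|$ (possibly set-valued), and $\operatorname{dist}(y,\Omega):=\inf_{z\in\Omega}\|y-z\|$. For $\alpha>0$, a point $y\in\mathcal C$ is $\alpha$-projected stationary if $y\in\Pi_{\mathcal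 C}(y-\alpha\nabla\Phi(y))$. $\mathcal D_{[0,1]}$ is the set of $n\times n$ diagonal matrices with diagonal entries in $[0,1]$. For $\Theta\in\mathcal D_{[0,1]}$, $C_\Theta:=P\Theta-Q(I-\Theta)$, and $\mu_C:=\inf_{\Theta\in\mathcal D_{[0,1]}}\sigma_{\min}(C_\Theta)$, where $\sigma_{\min}(W)$ for $W\in\mathbb R^{m\times n}$ is the smallest of its $\min\{m,n\}$ singular values. Safeguarded projected-gradient algorithm. For $y=(u,v)\in\mathcal C$ let $\vartheta_i(y):=\operatorname{sgn}(u_i-v_i)\in\{-1,0,1\}$. Given $y^0\in\mathcal C$, an integer $q\ge1$, $\tau\ge0$, set $\nu_0=0$ and $s_c:=\max\{1,\|c\|\}$. At iteration $k=0,1,2,\dots$: choose a stepsize $\alpha_k>0$; choose $\bar y^{k+1}\in\Pi_{\mathcal C}(y^k-\alpha_k\nabla\Phi(y^k))$; set $\nu_{k+1}:=\nu_k+1$ if $\vartheta(\bar y^{k+1})=\vartheta(y^k)$ and $\nu_{k+1}:=0$ otherwise. The trigger $\mathcal T_k$ holds if and only if $\|H\bar y^{k+1}-c\|/s_c\le\tau$ or $\nu_{k+1}\ge q$. If $\mathcal T_k$ holds, a refinement candidate $\widehat y^{k+1}$ is computed by some rule (left open; the rule may fail to produce a candidate). If a candidate is produced and $\widehat y^{k+1}\in\mathcal C$ and $\Phi(\widehat y^{k+1})\le\Phi(\bar y^{k+1})$, set $y^{k+1}:=\widehat y^{k+1}$; in all other cases set $y^{k+1}:=\bar y^{k+1}$.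 *)

(* Defs.v *)
From HB Require Import structures.
From mathcomp Require Export all_boot all_order all_algebra.
From mathcomp Require Export all_classical all_reals all_analysis.
From mathcomp Require Import ring.

Set Implicit Arguments.
Unset Strict Implicit.
Unset Printing Implicit Defensive.

Import Order.TTheory GRing.Theory Num.Theory.

Local Open Scope classical_set_scope.
Local Open Scope ring_scope.

(* The library norm `|A| on matrices is the max-entry norm, hence [enorm]. *)
Definition enorm (R : realType) (p : nat) (x : 'cV[R]_p) : R :=
  Num.sqrt (\sum_(i < p) x i ord0 ^+ 2).

Definition spectral_norm (R : realType) (p q : nat) (A : 'M[R]_(p, q)) : R :=
  sup [set enorm (A *m x) | x in [set x : 'cV[R]_q | enorm x <= 1]].

(* The min{p, q} singular values of W are the square roots of the eigenvalues
   of the smaller of the Gram matrices W W^T (p x p) and W^T W (q x q); using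
   the smaller one excludes the extra zero eigenvalues of the larger one. *)
Definition singular_value (R : realType) (p q : nat) (W : 'M[R]_(p, q)) : set R :=
  [set s | 0 <= s /\
    (if (p <= q)%N then eigenvalue (W *m W^T) (s ^+ 2)
                   else eigenvalue (W^T *m W) (s ^+ 2))].

(* The infimum is a minimum when p and q are positive.  When p or q is 0 there
   is no singular value and the value is inf set0 = 0. *)
Definition sigma_min (R : realType) (p q : nat) (W : 'M[R]_(p, q)) : R :=
  inf (singular_value W).

Definition D01 (R : realType) (n : nat) : set 'M[R]_n :=
  [set T : 'M[R]_n | is_diag_mx T /\ forall i, 0 <= T i i <= 1].

Definition C_Theta (R : realType) (m n : nat) (P Q : 'M[R]_(m, n))
  (T : 'M[R]_n) : 'M[R]_(m, n) := P *m T - Q *m (1%:M - T).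

Definition mu_C (R : realType) (m n : nat) (P Q : 'M[R]_(m, n)) : R :=
  inf [set sigma_min (C_Theta P Q T) | T in @D01 R n].

(* A pair (u, v) is the stacked column y = col_mx u v. *)
Definition compl_set (R : realType) (n : nat) : set 'cV[R]_(n + n) :=
  [set y : 'cV[R]_(n + n) | let u := usubmx y in let v := dsubmx y in
    [/\ forall i, 0 <= u i ord0, forall i, 0 <= v i ord0
      & forall i, u i ord0 * v i ord0 = 0]].

Definition Hmx (R : realType) (m n : nat) (P Q : 'M[R]_(m, n)) :
  'M[R]_(m, n + n) := row_mx P Q.

Definition resid (R : realType) (m n : nat) (P Q : 'M[R]_(m, n)) (c : 'cV[R]_m)
  (y : 'cV[R]_(n + n)) : 'cV[R]_m := Hmx P Q *m y - c.

Definition Phi (R : realType) (m n : nat) (P Q : 'M[R]_(m, n)) (c : 'cV[R]_m)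
  (y : 'cV[R]_(n + n)) : R := 2^-1 * enorm (resid P Q c y) ^+ 2.

Definition gradPhi (R : realType) (m n : nat) (P Q : 'M[R]_(m, n))
  (c : 'cV[R]_m) (y : 'cV[R]_(n + n)) : 'cV[R]_(n + n) :=
  (Hmx P Q)^T *m resid P Q c y.

Lemma enormE (R : realType) (p : nat) (x : 'cV[R]_p) :
  enorm x ^+ 2 = (x^T *m x) ord0 ord0.
Proof.
rewrite /enorm sqr_sqrtr ?sumr_ge0 // => [|i _]; last exact: sqr_ge0.
by rewrite mxE; apply: eq_bigr => i _; rewrite mxE expr2.
Qed.

(* [gradPhi] is the gradient: the remainder below is quadratic in h. *)
Lemma Phi_expand (R : realType) (m n : nat) (P Q : 'M[R]_(m, n)) (c : 'cV[R]_m)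
  (y h : 'cV[R]_(n + n)) :
  Phi P Q c (y + h) = Phi P Q c y + ((gradPhi P Q c y)^T *m h) ord0 ord0
                      + 2^-1 * enorm (Hmx P Q *m h) ^+ 2.
Proof.
rewrite /Phi /gradPhi.
have -> : resid P Q c (y + h) = resid P Q c y + Hmx P Q *m h.
  by rewrite /resid mulmxDr addrAC.
rewrite trmx_mul trmxK -mulmxA !enormE.
set r := resid _ _ _ _; set w := Hmx P Q *m h.
have wr : (w^T *m r) ord0 ord0 = (r^T *m w) ord0 ord0.
  by rewrite -[w^T *m r]trmxK trmx_mul trmxK mxE.
have -> : (r + w)^T *m (r + w) = r^T *m r + r^T *m w + (w^T *m r + w^T *m w).
  by rewrite [(r + w)^T]linearD /= mulmxDl !mulmxDr.
have addE (A B : 'M[R]_1) : (A + B) ord0 ord0 = A ord0 ord0 + B ord0 ord0.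
  by rewrite mxE.
rewrite !addE wr.
by field.
Qed.

Definition L_const (R : realType) (m n : nat) (P Q : 'M[R]_(m, n)) : R :=
  spectral_norm (Hmx P Q) ^+ 2.

Definition sol_set (R : realType) (m n : nat) (P Q : 'M[R]_(m, n))
  (c : 'cV[R]_m) : set 'cV[R]_(n + n) :=
  [set y | @compl_set R n y /\ resid P Q c y = 0].

Definition proj (R : realType) (p : nat) (Omega : set 'cV[R]_p)
  (y : 'cV[R]_p) : set 'cV[R]_p :=
  [set z | Omega z /\ forall w, Omega w -> enorm (y - z) <= enorm (y - w)].

(* Extended-real valued, so that the distance to the empty set is +oo; the
   real-valued [inf] would give 0. *)
Definition dist (R : realType) (p : nat) (y : 'cV[R]_p) (Omega : set 'cV[R]_p) :
  \bar R := ereal_inf [set (enorm (y - z))%:E | z in Omega].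

Definition pg_step (R : realType) (m n : nat) (P Q : 'M[R]_(m, n))
  (c : 'cV[R]_m) (alpha : R) (y : 'cV[R]_(n + n)) : set 'cV[R]_(n + n) :=
  proj (@compl_set R n) (y - alpha *: gradPhi P Q c y).

Definition proj_stationary (R : realType) (m n : nat) (P Q : 'M[R]_(m, n))
  (c : 'cV[R]_m) (alpha : R) (y : 'cV[R]_(n + n)) : Prop :=
  @compl_set R n y /\ pg_step P Q c alpha y y.

Definition theta (R : realType) (n : nat) (y : 'cV[R]_(n + n)) : 'cV[R]_n :=
  \col_i Num.sg (usubmx y i ord0 - dsubmx y i ord0).

Definition s_c (R : realType) (m : nat) (c : 'cV[R]_m) : R :=
  Num.max 1 (enorm c).

Definition trigger (R : realType) (m n : nat) (P Q : 'M[R]_(m, n))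
  (c : 'cV[R]_m) (q : nat) (tau : R) (ybar : 'cV[R]_(n + n)) (nu : nat) : Prop :=
  enorm (Hmx P Q *m ybar - c) / s_c c <= tau \/ (q <= nu)%N.

(* One run of the algorithm.  [ybar k.+1] is the projected-gradient trial point
   and [yhat k.+1] the outcome of the refinement rule ([None] when no candidate
   is produced); the entries [ybar 0] and [yhat 0] are unused.  The rule is
   left open, so [yhat] is otherwise unconstrained; its value is ignored when
   the trigger does not hold. *)
Record spg_run (R : realType) (m n : nat) (P Q : 'M[R]_(m, n)) (c : 'cV[R]_m)
    (y0 : 'cV[R]_(n + n)) (q : nat) (tau : R)
    (alpha : nat -> R) (y ybar : nat -> 'cV[R]_(n + n))
    (yhat : nat -> option 'cV[R]_(n + n)) (nu : nat -> nat) : Prop := SpgRun {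
  spg_init : y 0%N = y0;
  spg_nu0 : nu 0%N = 0%N;
  spg_step_gt0 : forall k, 0 < alpha k;
  spg_trial : forall k, pg_step P Q c (alpha k) (y k) (ybar k.+1);
  spg_nuS : forall k,
    nu k.+1 = if theta (ybar k.+1) == theta (y k) then (nu k).+1 else 0%N;
  spg_update : forall k,
    y k.+1 = if yhat k.+1 is Some z then
               if `[< [/\ trigger P Q c q tau (ybar k.+1) (nu k.+1),
                          @compl_set R n z
                        & Phi P Q c z <= Phi P Q c (ybar k.+1)] >]
               then z else ybar k.+1
             else ybar k.+1
}.

(* Main.v *)
Require Import Defs.
From mathcomp Require Import ring lra.
Import Order.TTheory GRing.Theory Num.Theory.
Import numFieldNormedType.Exports.
Set Implicit Arguments.
Unset Strict Implicit.
Unset Printing Implicit Defensive.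
Local Open Scope classical_set_scope.
Local Open Scope ring_scope.

(** Write g(y) for the gradient of Phi at y and C for the complementarity set.
    Everything is phrased through one inequality, [var_stationary]: for a fixed
    a > 0 and all w in C, 0 <= |w - y|^2 + a <g(y), w - y>.  Expanding the
    squares in the definition of the projection shows that a projected
    stationary point for the step alpha satisfies it with a = 2 alpha.

    Stationarity forces the residual to vanish ([var_stationary_sol]).  Moving
    y inside C along one coordinate gives sign conditions on the gradient
    (P^T r, Q^T r), where r is the residual: with a_i and b_i the i-th entries
    of P^T r and Q^T r, one has a_i = 0 if u_i > 0, b_i = 0 if v_i > 0, and
    a_i, b_i >= 0 if u_i = v_i = 0.  In each case some t_i in [0, 1] solves
    t_i a_i = (1 - t_i) b_i, which says that C_Theta^T r = 0 for the diagonal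
    matrix Theta of the t_i.  As mu_C > 0 and m <= n, the matrix
    C_Theta C_Theta^T has no eigenvalue 0, hence r = 0.

    For a run of the algorithm, Phi expands exactly to second order, so a
    projected-gradient step with alpha <= aup < 1 / L decreases Phi by at least
    a fixed multiple of its squared length ([pg_step_decrease]), and an
    accepted refinement only decreases Phi further.  Dividing the projection
    inequality by alpha turns the bound alpha >= alow into the inequality of
    [var_stationary] at y_k with a = 2 alow, up to an error that is a constant
    times Phi(y_k) - Phi(y_{k+1}) ([pg_step_almost_stationary]).  Since Phi(y_k)
    converges, the error tends to 0; the inequality passes to every cluster
    point ([cluster_var_stationary]), which therefore solves the problem.  The
    step sizes need not converge along a subsequence.

    Finally, in R^p a bounded sequence is eventually inside any set that is a
    neighbourhood of all of its cluster points ([bounded_near_clusters]).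
    Applied to the sets where Phi < e, and where some solution is at distance
    < e, this gives the two limits. *)

(** * Euclidean and spectral norms *)

Definition dotv (R : realType) (p : nat) (x z : 'cV[R]_p) : R :=
  (x^T *m z) ord0 ord0.

Lemma dotvE (R : realType) (p : nat) (x z : 'cV[R]_p) :
  dotv x z = \sum_(i < p) x i ord0 * z i ord0.
Proof. by rewrite /dotv mxE; apply: eq_bigr => i _; rewrite mxE. Qed.

Lemma dotv0 (R : realType) (p : nat) (x : 'cV[R]_p) : dotv x 0 = 0.
Proof. by rewrite /dotv mulmx0 mxE. Qed.

Lemma enorm_ge0 (R : realType) (p : nat) (x : 'cV[R]_p) : 0 <= enorm x.
Proof. exact: sqrtr_ge0. Qed.

Lemma enorm_sqr (R : realType) (p : nat) (x : 'cV[R]_p) :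
  enorm x ^+ 2 = \sum_(i < p) x i ord0 ^+ 2.
Proof. by rewrite sqr_sqrtr // sumr_ge0 // => i _; rewrite sqr_ge0. Qed.

Lemma enormZ (R : realType) (p : nat) (a : R) (x : 'cV[R]_p) :
  0 <= a -> enorm (a *: x) = a * enorm x.
Proof.
move=> a0; apply/eqP; rewrite -(eqrXn2 (n := 2)) ?mulr_ge0 ?enorm_ge0 //.
rewrite exprMn !enorm_sqr mulr_sumr; apply/eqP/eq_bigr => i _.
by rewrite mxE exprMn.
Qed.

Lemma enorm0 (R : realType) (p : nat) : enorm (0 : 'cV[R]_p) = 0.
Proof. by rewrite -(scale0r 0) enormZ // mul0r. Qed.

Lemma enormN (R : realType) (p : nat) (x : 'cV[R]_p) : enorm (- x) = enorm x.
Proof. by congr Num.sqrt; apply: eq_bigr => i _; rewrite mxE sqrrN. Qed.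

Lemma enorm0_eq0 (R : realType) (p : nat) (x : 'cV[R]_p) :
  enorm x = 0 -> x = 0.
Proof.
move=> x0; have : enorm x ^+ 2 == 0 by rewrite x0 expr0n.
rewrite enorm_sqr psumr_eq0 => [/allP h|i _]; last exact: sqr_ge0.
apply/colP => i; rewrite mxE; apply/eqP.
by have := h i (mem_index_enum _); rewrite /= sqrf_eq0.
Qed.

Lemma enormDZ_sqr (R : realType) (p : nat) (a : R) (x z : 'cV[R]_p) :
  enorm (x + a *: z) ^+ 2
  = enorm x ^+ 2 + 2 * a * dotv z x + a ^+ 2 * enorm z ^+ 2.
Proof.
rewrite !enorm_sqr dotvE !mulr_sumr -!big_split /=.
by apply: eq_bigr => i _; rewrite !mxE; ring.
Qed.

Lemma coord_le_enorm (R : realType) (p : nat) (x : 'cV[R]_p) (i : 'I_p) :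
  `|x i ord0| <= enorm x.
Proof.
rewrite -(ler_pXn2r (n := 2)) ?nnegrE ?enorm_ge0 // enorm_sqr.
by rewrite real_normK ?num_real // (bigD1 i) //= lerDl sumr_ge0 // => j _;
  rewrite sqr_ge0.
Qed.

Lemma enorm_mulmx_le (R : realType) (p q : nat) (A : 'M[R]_(p, q))
    (x : 'cV[R]_q) : enorm (A *m x) <= spectral_norm A * enorm x.
Proof.
(* The supremum that defines the spectral norm is over a bounded set: each
   entry of A u is at most the absolute row sum. *)
have bounded_image : has_ubound
    [set enorm (A *m x) | x in [set x : 'cV[R]_q | enorm x <= 1]].
  pose rowsum i := \sum_j `|A i j|.
  exists (Num.sqrt (\sum_i rowsum i ^+ 2)) => _ [u /= u1 <-].
  rewrite ler_sqrt ?sumr_ge0 // => [|i _]; last exact: sqr_ge0.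
  apply: ler_sum => i _; rewrite -real_normK ?num_real //.
  rewrite ler_pXn2r ?nnegrE ?sumr_ge0 // mxE.
  apply: le_trans (ler_norm_sum _ _ _) _; apply: ler_sum => j _.
  by rewrite normrM ler_piMr // (le_trans (coord_le_enorm u j)).
have [x0|xn0] := eqVneq (enorm x) 0.
  by rewrite (enorm0_eq0 x0) mulmx0 !enorm0 mulr0.
have xgt0 : 0 < enorm x by rewrite lt_neqAle eq_sym xn0 enorm_ge0.
have xE : x = enorm x *: ((enorm x)^-1 *: x).
  by rewrite scalerA divff // scale1r.
rewrite {1}xE -scalemxAr enormZ ?enorm_ge0 // mulrC ler_pM2r //.
apply: ub_le_sup => //.
by exists ((enorm x)^-1 *: x); rewrite //= enormZ ?invr_ge0 ?enorm_ge0 // mulVf.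
Qed.

Lemma sqr_enorm_Hmx_le (R : realType) (m n : nat) (P Q : 'M[R]_(m, n))
    (d : 'cV[R]_(n + n)) :
  enorm (Hmx P Q *m d) ^+ 2 <= L_const P Q * enorm d ^+ 2.
Proof.
rewrite /L_const -exprMn ler_pXn2r ?nnegrE ?enorm_ge0 ?enorm_mulmx_le //.
exact: le_trans (enorm_ge0 _) (enorm_mulmx_le _ _).
Qed.

(** * Nonsingularity of the matrices C_Theta *)

Lemma sigma_min_le (R : realType) (p q : nat) (W : 'M[R]_(p, q)) (s : R) :
  singular_value W s -> sigma_min W <= s.
Proof. by move=> Ws; apply: ge_inf => //; exists 0 => t []. Qed.

Lemma sigma_min_ge0 (R : realType) (p q : nat) (W : 'M[R]_(p, q)) :
  0 <= sigma_min W.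
Proof.
rewrite /sigma_min; have [->|W0] := eqVneq (singular_value W) set0.
  by rewrite inf0.
by apply: lb_le_inf; [exact/set0P | move=> t []].
Qed.

(** For p <= q the singular values come from W W^T; a nonzero r with W^T r = 0
    would be an eigenvector of it for 0, making sigma_min W nonpositive. *)
Lemma trmx_C_Theta_inj (R : realType) (m n : nat) (P Q : 'M[R]_(m, n))
    (T : 'M[R]_n) (r : 'cV[R]_m) :
  (m <= n)%N -> 0 < mu_C P Q -> D01 T -> (C_Theta P Q T)^T *m r = 0 -> r = 0.
Proof.
move=> mn mu_gt0 DT Wr; set W := C_Theta P Q T in Wr.
have sigma_gt0 : 0 < sigma_min W.
  apply: lt_le_trans mu_gt0 _; apply: ge_inf; last by exists T.
  by exists 0 => _ [U _ <-]; exact: sigma_min_ge0.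
apply/eqP; apply: contraTT sigma_gt0 => r_neq0; rewrite -leNgt.
apply: sigma_min_le; split=> //; rewrite mn expr0n /=; apply/eigenvalueP.
exists r^T; last by rewrite trmx_eq0.
by rewrite scale0r mulmxA -[r^T *m W]trmxK trmx_mul trmxK Wr trmx0 mul0mx.
Qed.

(** * Stationary points are solutions *)

Lemma ge0_of_perturb (R : realType) (b : R) :
  (forall t, 0 <= t -> 0 <= t ^+ 2 + b * t) -> 0 <= b.
Proof.
move=> h; rewrite leNgt; apply/negP => b0.
have := h (- b / 2) ltac:(lra); have := mulr_gt0 (x := -b) (y := -b); nra.
Qed.

Lemma eq0_of_perturb (R : realType) (b s : R) : 0 < s ->
  (forall t, - s <= t -> 0 <= t ^+ 2 + b * t) -> b = 0.
Proof.
move=> s0 h; apply/eqP; rewrite eq_le ge0_of_perturb ?andbT; last first.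
  by move=> t t0; apply: h; lra.
rewrite leNgt; apply/negP => b0.
have m0 : 0 < Num.min s (b / 2) by rewrite lt_min s0 /=; lra.
have ms : Num.min s (b / 2) <= s by rewrite ge_min lexx.
have mb : Num.min s (b / 2) <= b / 2 by rewrite ge_min lexx orbT.
have := h (- Num.min s (b / 2)); nra.
Qed.

(** For y in C and a = 2 alpha this says that y is a point of C closest to
    y - alpha g(y), with the squares expanded and alpha^2 |g(y)|^2 cancelled.
    Unlike the projection, its two sides depend continuously on y, and it gets
    weaker when a > 0 decreases. *)
Definition var_stationary (R : realType) (m n : nat) (P Q : 'M[R]_(m, n))
  (c : 'cV[R]_m) (a : R) (y : 'cV[R]_(n + n)) : Prop :=
  forall w, @compl_set R n w ->
    0 <= enorm (w - y) ^+ 2 + a * dotv (gradPhi P Q c y) (w - y).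

Lemma enorm_delta_sqr (R : realType) (p : nat) (t : R) (j : 'I_p) :
  enorm (t *: delta_mx j ord0) ^+ 2 = t ^+ 2.
Proof.
rewrite enorm_sqr (bigD1 j) //= big1 => [|i /negbTE ij].
  by rewrite !mxE !eqxx mulr1 addr0.
by rewrite !mxE ij mulr0 expr0n.
Qed.

Lemma dotv_delta (R : realType) (p : nat) (t : R) (g : 'cV[R]_p) (j : 'I_p) :
  dotv g (t *: delta_mx j ord0) = g j ord0 * t.
Proof.
rewrite dotvE (bigD1 j) //= big1 => [|i /negbTE ij].
  by rewrite !mxE !eqxx mulr1 addr0.
by rewrite !mxE ij !mulr0.
Qed.

Lemma compl_setE (R : realType) (n : nat) (w : 'cV[R]_(n + n)) : compl_set w <->
  forall i, [/\ 0 <= w (lshift n i) ord0, 0 <= w (rshift n i) ord0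
   & w (lshift n i) ord0 * w (rshift n i) ord0 = 0].
Proof.
split=> [[/= hu hv huv] i|h].
  by move: (hu i) (hv i) (huv i); rewrite !mxE.
by split=> i /=; have := h i; rewrite !mxE => -[].
Qed.

Section Stationary.
Variables (R : realType) (m n : nat) (P Q : 'M[R]_(m, n)) (c : 'cV[R]_m).
Variables (a : R) (y : 'cV[R]_(n + n)).
Hypotheses (a_gt0 : 0 < a) (Cy : compl_set y) (sy : var_stationary P Q c a y).
Let u i := y (lshift n i) ord0.
Let v i := y (rshift n i) ord0.
Let g := gradPhi P Q c y.

(** Along coordinate j the stationarity inequality reads 0 <= t^2 + a g_j t, so
    small positive t force g_j >= 0, and small negative t, which are feasible
    when s > 0, force g_j <= 0. *)
Lemma feasible_directions_grad (j : 'I_(n + n)) (s : R) : 0 <= s ->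
  (forall t, - s <= t -> compl_set (y + t *: delta_mx j ord0)) ->
  0 <= g j ord0 /\ (0 < s -> g j ord0 = 0).
Proof.
move=> s0 h.
have e t : - s <= t -> 0 <= t ^+ 2 + a * g j ord0 * t.
  move=> st; have := sy (h t st).
  by rewrite [y + _]addrC addrK enorm_delta_sqr dotv_delta mulrA.
split=> [|sgt0].
  rewrite -(pmulr_rge0 _ a_gt0); apply: ge0_of_perturb => t t0.
  by apply: e; lra.
by have /eqP := eq0_of_perturb sgt0 e; rewrite mulf_eq0 gt_eqF //= => /eqP.
Qed.

(** Coordinate i may move along the u-axis as long as v_i = 0, down to u_i = 0;
    [perturb_right] is the mirror image. *)
Lemma perturb_left (i : 'I_n) (t : R) :
  v i = 0 -> - u i <= t -> compl_set (y + t *: delta_mx (lshift n i) ord0).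
Proof.
move=> vi ut; apply/compl_setE => k; have [uk vk uvk] := (compl_setE y).1 Cy k.
rewrite !mxE eqxx !andbT (inj_eq (@lshift_inj _ _)) eq_rlshift mulr0 addr0.
have [->|_] := eqVneq k i; last by rewrite mulr0 addr0.
by rewrite -/(u i) -/(v i) vi !mulr0; split=> //; rewrite mulr1; lra.
Qed.

Lemma perturb_right (i : 'I_n) (t : R) :
  u i = 0 -> - v i <= t -> compl_set (y + t *: delta_mx (rshift n i) ord0).
Proof.
move=> ui vt; apply/compl_setE => k; have [uk vk uvk] := (compl_setE y).1 Cy k.
rewrite !mxE eqxx !andbT (inj_eq (@rshift_inj _ _)) eq_lrshift mulr0 addr0.
have [->|_] := eqVneq k i; last by rewrite mulr0 addr0.
by rewrite -/(u i) -/(v i) ui !mul0r; split=> //; rewrite mulr1; lra.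
Qed.

(** The equation is the i-th coordinate of C_Theta^T r = 0, and t is the i-th
    diagonal entry of Theta. *)
Lemma exists_multiplier (i : 'I_n) : exists t : R, 0 <= t <= 1 /\
  t * g (lshift n i) ord0 = (1 - t) * g (rshift n i) ord0.
Proof.
have [ui vi uvi] := (compl_setE y).1 Cy i.
rewrite -/(u i) -/(v i) in ui vi uvi.
have left0 vi0 :=
  feasible_directions_grad ui (fun t => perturb_left vi0 (t := t)).
have right0 ui0 :=
  feasible_directions_grad vi (fun t => perturb_right ui0 (t := t)).
have [ui0|ui0] := eqVneq (u i) 0; last first.
  have vi0 : v i = 0 by move/eqP: uvi; rewrite mulf_eq0 (negbTE ui0) => /eqP.
  exists 1; rewrite ler01 lexx subrr mul0r mul1r; split=> //.
  by have [_ ->] := left0 vi0; rewrite // lt_neqAle eq_sym ui0.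
have [b0 bz] := right0 ui0.
have [vi0|vi0] := eqVneq (v i) 0; last first.
  exists 0; rewrite ler01 lexx subr0 mul0r mul1r; split=> //.
  by rewrite bz // lt_neqAle eq_sym vi0.
(* Both coordinates vanish: the two gradient entries are nonnegative, and the
   weights are proportional to the opposite entries. *)
have [a0 _] := left0 vi0.
set ga := g (lshift n i) ord0 in a0 *; set gb := g (rshift n i) ord0 in b0 *.
have [s0|s0] := eqVneq (ga + gb) 0.
  by exists 0; rewrite lexx ler01; split=> //; lra.
have s_gt0 : 0 < ga + gb by rewrite lt_neqAle eq_sym s0 addr_ge0.
exists (gb / (ga + gb)); split; last by field.
by rewrite divr_ge0 ?addr_ge0 //= ler_pdivrMr // mul1r; lra.
Qed.

Lemma var_stationary_sol : (m <= n)%N -> 0 < mu_C P Q -> sol_set P Q c y.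
Proof.
move=> mn mu_gt0; split=> //.
have [t /all_and2[t01 tg]] := fin_all_exists exists_multiplier.
pose T : 'M[R]_n := diag_mx (\row_i t i).
apply: (trmx_C_Theta_inj (T := T) mn mu_gt0).
  by split=> [|i]; rewrite ?diag_mx_is_diag // !mxE eqxx; exact: t01.
rewrite /C_Theta [_^T]linearB /= !trmx_mul [(1%:M - T)^T]linearB /=.
rewrite trmx1 tr_diag_mx mulmxBl -!mulmxA mulmxBl mul1mx.
have gE : g = col_mx (P^T *m resid P Q c y) (Q^T *m resid P Q c y).
  by rewrite /g /gradPhi /Hmx tr_row_mx mul_col_mx.
move: tg; rewrite gE.
move: (P^T *m _) (Q^T *m _) => p q tg.
apply/colP => i; have := tg i; rewrite col_mxEu col_mxEd => tgi.
by rewrite !mul_diag_mx !mxE tgi; ring.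
Qed.
End Stationary.

(** * One projected-gradient step *)

Section Step.
Variables (R : realType) (m n : nat) (P Q : 'M[R]_(m, n)) (c : 'cV[R]_m).
Implicit Types y z w : 'cV[R]_(n + n).

Lemma pg_step_ineq (al : R) y z w : pg_step P Q c al y z -> compl_set w ->
  enorm (z - y) ^+ 2 + 2 * al * dotv (gradPhi P Q c y) (z - y)
  <= enorm (w - y) ^+ 2 + 2 * al * dotv (gradPhi P Q c y) (w - y).
Proof.
move=> [_ zmin] Cw; have := zmin w Cw.
rewrite -(ler_pXn2r (n := 2)) ?nnegrE ?enorm_ge0 //.
have e x : y - al *: gradPhi P Q c y - x = - (x - y + al *: gradPhi P Q c y).
  by rewrite opprD opprB addrAC.
by rewrite !e !enormN !enormDZ_sqr lerD2r.
Qed.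

Lemma proj_stationary_var (al : R) y :
  proj_stationary P Q c al y -> var_stationary P Q c (2 * al) y.
Proof.
move=> [_ ystep] w Cw; have := pg_step_ineq ystep Cw.
by rewrite subrr enorm0 expr0n /= add0r dotv0 mulr0.
Qed.

(** Phi is quadratic, so the linear term is a difference of values of Phi up to
    the second-order term; this also makes the left side continuous in y. *)
Lemma dotv_gradPhi y w : dotv (gradPhi P Q c y) (w - y) =
  Phi P Q c w - Phi P Q c y - 2^-1 * enorm (Hmx P Q *m (w - y)) ^+ 2.
Proof.
have := Phi_expand P Q c y (w - y); rewrite addrC subrK => ->.
by rewrite /dotv; ring.
Qed.

(** Comparing the projection z with y itself bounds <g, z - y> by
    - |z - y|^2 / (2 alpha), while the second-order term of Phi is at most
    L |z - y|^2 / 2. *)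
Lemma pg_step_decrease (al aup : R) y z : 0 < al <= aup -> compl_set y ->
  pg_step P Q c al y z ->
  2^-1 * (aup^-1 - L_const P Q) * enorm (z - y) ^+ 2
  <= Phi P Q c y - Phi P Q c z.
Proof.
move=> /andP[al0 alup] Cy yz; have := pg_step_ineq yz Cy.
rewrite subrr enorm0 expr0n /= dotv0 mulr0 addr0 dotv_gradPhi.
have := sqr_enorm_Hmx_le P Q (z - y).
have N0 : 0 <= enorm (z - y) ^+ 2 by exact: sqr_ge0.
set N := enorm (z - y) ^+ 2 in N0 *; set S := enorm (_ *m _) ^+ 2.
set D := Phi P Q c z - _ => SN h.
have {}h : al^-1 * N + 2 * (D - 2^-1 * S) <= 0.
  by rewrite -(pmulr_rle0 _ al0) mulrDr mulVKf ?gt_eqF // mulrA [al * 2]mulrC.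
have inv_le : aup^-1 * N <= al^-1 * N.
  by rewrite ler_wpM2r // lef_pV2 ?posrE // (lt_le_trans al0).
rewrite -[leRHS]opprB -/D; lra.
Qed.

(** After division by 2 alpha, the projection inequality bounds <g, z - y> by
    |w - y|^2 / (2 alpha) + <g, w - y>, where alpha may be replaced by alow.  On
    the other side <g, z - y> differs from Phi z - Phi y by the second-order
    term, which the decrease of Phi controls. *)
Lemma pg_step_almost_stationary (alow aup : R) :
  0 < alow <= aup -> aup < 1 / L_const P Q ->
  exists K : R, 0 <= K /\ forall al y z w, alow <= al <= aup ->
    compl_set y -> pg_step P Q c al y z -> compl_set w ->
    Phi P Q c z <= Phi P Q c y /\
    - (K * (Phi P Q c y - Phi P Q c z))
    <= enorm (w - y) ^+ 2 + 2 * alow * dotv (gradPhi P Q c y) (w - y).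
Proof.
move=> /andP[low_gt0 lowup] upL.
have up_gt0 : 0 < aup by exact: lt_le_trans lowup.
(* L = 0 is excluded because then 1 / L = 0, which is below alow. *)
have L0 : 0 < L_const P Q by rewrite -invr_gt0 -div1r (lt_trans up_gt0).
have kappa_gt0 : 0 < aup^-1 - L_const P Q.
  by rewrite subr_gt0 -(ltf_pV2 (x := aup^-1)) ?posrE ?invr_gt0 // invrK -div1r.
set L := L_const P Q in L0 kappa_gt0 *.
exists (2 * alow * (1 + L / (aup^-1 - L))); split.
  by rewrite mulr_ge0 ?addr_ge0 ?divr_ge0 //; lra.
move=> al y z w /andP[lowal alup] Cy yz Cw.
have al0 : 0 < al by exact: lt_le_trans lowal.
have := pg_step_decrease (al := al) (aup := aup) _ Cy yz.
rewrite al0 alup -/L => /(_ isT) dec.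
have := pg_step_ineq yz Cw; have := sqr_enorm_Hmx_le P Q (z - y).
rewrite -/L dotv_gradPhi; set Gw := dotv _ _.
have N0 : 0 <= enorm (z - y) ^+ 2 by exact: sqr_ge0.
have Nw0 : 0 <= enorm (w - y) ^+ 2 by exact: sqr_ge0.
set N := enorm (z - y) ^+ 2 in N0 dec *; set S := enorm (_ *m _) ^+ 2.
set Nw := enorm (w - y) ^+ 2 in Nw0 *.
rewrite -[Phi P Q c z - Phi P Q c y]opprB; set D := Phi P Q c y - _ in dec *.
set ka := aup^-1 - L in kappa_gt0 dec *.
move=> SN step.
have D0 : 0 <= D by have := mulr_ge0 (ltW kappa_gt0) N0; nra.
split; first by rewrite -subr_ge0.
(* S <= L N and N <= 2 D / ka: this is where L / ka in K comes from. *)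
have LN : 2^-1 * S <= L / ka * D.
  rewrite mulrAC ler_pdivlMr //.
  have : L * (2^-1 * ka * N) <= L * D by rewrite ler_pM2l.
  have : ka * S <= ka * (L * N) by rewrite ler_pM2l.
  nra.
have low_step : - (2 * (D + 2^-1 * S)) <= al^-1 * Nw + 2 * Gw.
  rewrite -(ler_pM2l al0) [leRHS]mulrDr mulVKf ?gt_eqF //.
  lra.
have inv_le : alow * (al^-1 * Nw) <= Nw.
  by rewrite mulrA ler_piMl // ler_pdivrMr // mul1r.
have : - (alow * (2 * (D + 2^-1 * S))) <= alow * (al^-1 * Nw + 2 * Gw).
  by rewrite -mulrN ler_pM2l.
have : alow * (2^-1 * S) <= alow * (L / ka * D) by rewrite ler_pM2l.
nra.
Qed.
End Step.

(** * Cluster points of sequences *)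

Section Clusters.
Variable (R : realType).

(** The transpose carries compactness of boxes of row vectors to columns. *)
Lemma box_compact (p : nat) (M : R) :
  compact [set x : 'cV[R]_p | forall i, `|x i ord0| <= M].
Proof.
have -> : [set x : 'cV[R]_p | forall i, `|x i ord0| <= M] =
   trmx @` [set v : 'rV[R]_p | forall i, `[- M, M]%classic (v ord0 i)].
  apply/seteqP; split=> [x xM|_ [v vM <-] i]; last first.
    by have := vM i; rewrite mxE /= in_itv /= -ler_norml.
  exists x^T; rewrite ?trmxK // => i /=.
  by rewrite mxE in_itv /= -ler_norml.
apply: continuous_compact; last first.
  apply: (@rV_compact _ p (fun=> `[- M, M]%classic)) => _.
  exact: segment_compact.
apply: continuous_subspaceT => v A [B vB BA].
exists (fun i j => B j i); first by move=> i j; have := vB j i; rewrite mxE.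
by move=> w wB; apply: BA => i j; rewrite mxE.
Qed.

(** Otherwise the indices k with y_k outside U would form a proper filter finer
    than that of all large k; by compactness its image has a cluster point z,
    which is a cluster point of the sequence, so that U would be a neighbourhood
    of z and would meet its own complement. *)
Lemma bounded_near_clusters (p : nat) (y : nat -> 'cV[R]_p) (M : R)
    (U : set 'cV[R]_p) :
  (forall k, enorm (y k) <= M) ->
  (forall z, cluster (y @ \oo) z -> nbhs z U) ->
  \forall k \near \oo, U (y k).
Proof.
move=> yM yU; apply: contrapT => nU.
pose F : set_system nat := within (y @^-1` ~` U) \oo.
have FF : ProperFilter F.
  apply: Build_ProperFilter_ex => A FA; apply: contrapT => A0; apply: nU.
  have {}FA : \forall k \near \oo, (~` U) (y k) -> A k := FA.
  apply: filterS FA => k kA; apply: contrapT => kU; apply: A0.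
  by exists k; exact: kA.
have [|z [_ zF]] := @box_compact p M (y @ F) _.
  by apply: nearW => k kU i; exact: le_trans (coord_le_enorm _ _) (yM k).
have /yU zU : cluster (y @ \oo) z.
  move=> A B yA zB; apply: zF => //; exact: cvg_within yA.
have [|x []] := zF (~` U) U _ zU; last by [].
exact: nearW.
Qed.

(** Approximate nonnegativity of f along the sequence becomes exact at cluster
    points. *)
Lemma cluster_ge0 (T : topologicalType) (y : nat -> T) (f : T -> R)
    (e : nat -> R) (z : T) :
  continuous f -> e @ \oo --> (0 : R) -> (forall k, - e k <= f (y k)) ->
  cluster (y @ \oo) z -> 0 <= f z.
Proof.
move=> cf e0 ef yz; rewrite leNgt; apply/negP => fz.
have : \forall k \near \oo, f z / 2 <= f (y k).
  have : \forall k \near \oo, `|0 - e k| < - (f z / 2).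
    by move/cvgrPdist_lt : e0; apply; lra.
  apply: filterS => k; rewrite sub0r normrN ltr_norml => /andP[_ h].
  by apply: le_trans (ef k); lra.
have zB : nbhs z [set x | f x < f z / 2].
  by apply: (cvgr_lt (f z) (cf z)); lra.
move=> yA; have [x [/= x1 x2]] := yz [set x | f z / 2 <= f x] _ yA zB.
by have := le_lt_trans x1 x2; rewrite ltxx.
Qed.

Section ContinuousOps.
Variable T : topologicalType.
Implicit Types f g : T -> R.

Lemma continuous_add f g :
  continuous f -> continuous g -> continuous (fun x => f x + g x).
Proof. by move=> cf cg x; exact: cvgD (cf x) (cg x). Qed.

Lemma continuous_mul f g :
  continuous f -> continuous g -> continuous (fun x => f x * g x).
Proof. by move=> cf cg x; exact: cvgM (cf x) (cg x). Qed.

Lemma continuous_opp f : continuous f -> continuous (fun x => - f x).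
Proof. by move=> cf x; exact: cvgN (cf x). Qed.

Lemma continuous_scale (a : R) f :
  continuous f -> continuous (fun x => a * f x).
Proof. by apply: continuous_mul => x; exact: cvg_cst. Qed.

Lemma continuous_addc f (a : R) :
  continuous f -> continuous (fun x => f x + a).
Proof. by move=> cf; apply: continuous_add cf _ => x; exact: cvg_cst. Qed.

Lemma continuous_sum (I : finType) (F : I -> T -> R) :
  (forall i, continuous (F i)) -> continuous (fun x => \sum_i F i x).
Proof. by move=> cF; apply: continuous_big => //; exact: add_continuous. Qed.
End ContinuousOps.

Lemma continuous_enorm_sqr (p q : nat) (A : 'M[R]_(q, p)) (b : 'cV[R]_q) :
  continuous (fun y : 'cV[R]_p => enorm (A *m y + b) ^+ 2).
Proof.
rewrite (_ : (fun y => _) =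
  fun y : 'cV[R]_p => \sum_i ((A *m y + b) i ord0 * (A *m y + b) i ord0)).
  apply: continuous_sum => i.
  have ci : continuous (fun y : 'cV[R]_p => (A *m y + b) i ord0).
    rewrite (_ : (fun y => _) =
      fun y : 'cV[R]_p => \sum_j A i j * y j ord0 + b i ord0).
      apply: continuous_addc; apply: continuous_sum => j.
      by apply: continuous_scale; exact: coord_continuous.
    by apply/funext => y; rewrite !mxE.
  exact: continuous_mul.
by apply/funext => y; rewrite enorm_sqr; apply: eq_bigr => i _; rewrite expr2.
Qed.

Lemma cluster_compl_set (n : nat) (y : nat -> 'cV[R]_(n + n)) z :
  (forall k, compl_set (y k)) -> cluster (y @ \oo) z -> compl_set z.
Proof.
move=> Cy yz; apply/compl_setE => i.
have ge0 (f : 'cV[R]_(n + n) -> R) :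
    continuous f -> (forall k, 0 <= f (y k)) -> 0 <= f z.
  move=> cf fy; apply: (cluster_ge0 (e := fun=> 0) cf _ _ yz).
    exact: cvg_cst.
  by move=> k; rewrite oppr0.
have cu : continuous (fun w : 'cV[R]_(n + n) => w (lshift n i) ord0).
  exact: coord_continuous.
have cv : continuous (fun w : 'cV[R]_(n + n) => w (rshift n i) ord0).
  exact: coord_continuous.
have Cyi k := (compl_setE (y k)).1 (Cy k) i.
split; [by apply: ge0 cu _ => k; case: (Cyi k)
       |by apply: ge0 cv _ => k; case: (Cyi k)|].
apply/eqP; rewrite eq_le -oppr_ge0; apply/andP; split.
  apply: (ge0 (fun w => - (w (lshift n i) ord0 * w (rshift n i) ord0))).
    by apply: continuous_opp; exact: continuous_mul.
  by move=> k; case: (Cyi k) => _ _ ->; rewrite oppr0.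
apply: (ge0 (fun w => w (lshift n i) ord0 * w (rshift n i) ord0)).
  exact: continuous_mul.
by move=> k; case: (Cyi k) => _ _ ->.
Qed.

Lemma dist_cvg0 (p : nat) (y : nat -> 'cV[R]_p) (S : set 'cV[R]_p) :
  (forall e : R, 0 < e ->
     \forall k \near \oo, exists2 z, S z & enorm (y k - z) < e) ->
  (fun k => dist (y k) S) @ \oo --> (0%:E : \bar R).
Proof.
move=> yS; have d0 k : (0 <= dist (y k) S)%E.
  by apply: le_ereal_inf_tmp => _ [z _ <-]; rewrite lee_fin enorm_ge0.
have dlt e : 0 < e -> \forall k \near \oo, (dist (y k) S < e%:E)%E.
  move=> /yS; apply: filterS => k [z Sz yz].
  by apply: (@le_lt_trans _ _ (enorm (y k - z))%:E);
    [apply: ereal_inf_lbound; exists z|rewrite lte_fin].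
apply/fine_cvgP; split.
  apply: filterS (dlt 1 ltr01) => k dk.
  by rewrite ge0_fin_numE // (lt_trans dk) // ltry.
apply/cvgrPdist_lt => e e0; apply: filterS (dlt e e0) => k dk /=.
have dfin : dist (y k) S \is a fin_num.
  by rewrite ge0_fin_numE // (lt_trans dk) // ltry.
by rewrite sub0r normrN ger0_norm ?fine_ge0 // -lte_fin fineK.
Qed.
End Clusters.

(** * Convergence of the algorithm *)

Lemma Phi_ge0 (R : realType) (m n : nat) (P Q : 'M[R]_(m, n)) (c : 'cV[R]_m)
  (y : 'cV[R]_(n + n)) : 0 <= Phi P Q c y.
Proof. by rewrite /Phi mulr_ge0 ?invr_ge0 ?sqr_ge0. Qed.

Lemma Phi_continuous (R : realType) (m n : nat) (P Q : 'M[R]_(m, n))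
  (c : 'cV[R]_m) : continuous (Phi P Q c).
Proof. by apply: continuous_scale; exact: continuous_enorm_sqr. Qed.

Section Run.
Variables (R : realType) (m n : nat) (P Q : 'M[R]_(m, n)) (c : 'cV[R]_m).

Lemma var_form_continuous (a : R) (w : 'cV[R]_(n + n)) : continuous
  (fun y : 'cV[R]_(n + n) =>
     enorm (w - y) ^+ 2 + a * dotv (gradPhi P Q c y) (w - y)).
Proof.
rewrite (_ : (fun y => _) = (fun y : 'cV[R]_(n + n) =>
   enorm ((- 1%:M) *m y + w) ^+ 2 +
   a * (Phi P Q c w - Phi P Q c y
        - 2^-1 * enorm ((- Hmx P Q) *m y + Hmx P Q *m w) ^+ 2))).
  apply: continuous_add; first exact: continuous_enorm_sqr.
  apply: continuous_scale; apply: continuous_add; last first.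
    apply: continuous_opp; apply: continuous_scale.
    exact: continuous_enorm_sqr.
  apply: continuous_add; first exact: cst_continuous.
  by apply: continuous_opp; exact: Phi_continuous.
apply/funext => y; rewrite dotv_gradPhi.
by rewrite !mulNmx mul1mx mulmxBr ![- _ + _]addrC.
Qed.

Variables (y ybar : nat -> 'cV[R]_(n + n)) (alpha : nat -> R) (alow aup : R).
Hypotheses (Cy : forall k, compl_set (y k))
  (ystep : forall k, pg_step P Q c (alpha k) (y k) (ybar k.+1))
  (ydec : forall k, Phi P Q c (y k.+1) <= Phi P Q c (ybar k.+1))
  (alow_gt0 : 0 < alow) (alpha_in : forall k, alow <= alpha k <= aup)
  (aupL : aup < 1 / L_const P Q).

(** The error at step k is at most K (Phi(y_k) - Phi(y_{k+1})), because y_{k+1}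
    is no worse than the trial point; consecutive differences of a convergent
    sequence tend to 0. *)
Lemma cluster_var_stationary z : cluster (y @ \oo) z ->
  var_stationary P Q c (2 * alow) z.
Proof.
move=> yz w Cw.
have lowup : 0 < alow <= aup.
  by rewrite alow_gt0; have /andP[/le_trans] := alpha_in 0%N; apply.
have [K [K0 step]] := pg_step_almost_stationary c lowup aupL.
pose E k := Phi P Q c (y k) - Phi P Q c (y k.+1).
have E_ge k : Phi P Q c (y k) - Phi P Q c (ybar k.+1) <= E k.
  by rewrite lerD2l lerN2.
have E0 : (fun k => K * E k) @ \oo --> (0 : R).
  have cvPhi : cvgn (fun k => Phi P Q c (y k)).
    apply: nonincreasing_is_cvgn; last first.
      by exists 0 => _ [k _ <-]; exact: Phi_ge0.
    apply/nonincreasing_seqP => k; apply: le_trans (ydec k) _.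
    by have [] := step _ _ _ _ (alpha_in k) (Cy k) (ystep k) Cw.
  rewrite -(mulr0 K); apply: cvgM; first exact: cvg_cst.
  rewrite -(subrr (limn (fun k => Phi P Q c (y k)))).
  apply: cvgB => //.
  by rewrite (cvg_shiftS (fun k => Phi P Q c (y k))).
apply: (cluster_ge0 (var_form_continuous (a := 2 * alow) (w := w)) E0 _ yz).
move=> k; have [_] := step _ _ _ _ (alpha_in k) (Cy k) (ystep k) Cw.
by apply: le_trans; rewrite lerN2 ler_wpM2l.
Qed.
End Run.

Theorem theorem4 (R : realType) (m n : nat) (P Q : 'M[R]_(m, n)) (c : 'cV[R]_m)
    (hmn : (m <= n)%N) (hmu : 0 < mu_C P Q) :
  (forall (alpha : R) (y : 'cV[R]_(n + n)),
     0 < alpha -> proj_stationary P Q c alpha y -> sol_set P Q c y) /\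
  (forall (y0 : 'cV[R]_(n + n)) (q : nat) (tau : R) (alpha : nat -> R)
      (y ybar : nat -> 'cV[R]_(n + n)) (yhat : nat -> option 'cV[R]_(n + n))
      (nu : nat -> nat),
     @compl_set R n y0 -> (1 <= q)%N -> 0 <= tau ->
     spg_run P Q c y0 q tau alpha y ybar yhat nu ->
     (exists alow aup : R, 
        [/\ 0 < alow, forall k, alow <= alpha k <= aup & aup < 1 / L_const P Q]) ->
     (exists M : R, forall k, enorm (y k) <= M) ->
     [/\ (fun k => Phi P Q c (y k)) @ \oo --> (0 : R),
         (fun k => dist (y k) (sol_set P Q c)) @ \oo --> (0%:E : \bar R)
       & forall z : 'cV[R]_(n + n), cluster (y @ \oo) z -> sol_set P Q c z]).
Proof.
split=> [al y al0 sy|y0 q tau alpha y ybar yhat nu Cy0 _ _ run].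
  apply: (var_stationary_sol (a := 2 * al)) => //; first by rewrite mulr_gt0.
    by case: sy.
  exact: proj_stationary_var.
move=> [alow [aup [alow0 alpha_in aupL]]] [M yM].
case: run => y0E _ _ ystep _ yS.
have upd k : compl_set (y k.+1) /\ Phi P Q c (y k.+1) <= Phi P Q c (ybar k.+1).
  have Cbar : compl_set (ybar k.+1) by case: (ystep k).
  rewrite yS; case: (yhat k.+1) => [w|]; last by [].
  by case: asboolP => // -[].
have Cy k : compl_set (y k) by case: k => [|k]; [rewrite y0E|case: (upd k)].
have cluster_sol z : cluster (y @ \oo) z -> sol_set P Q c z.
  move=> yz; apply: (var_stationary_sol (a := 2 * alow)) => //.
  - by rewrite mulr_gt0.
  - exact: cluster_compl_set yz.
  - apply: (cluster_var_stationary Cy ystep _ alow0 alpha_in aupL yz) => k.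
    by case: (upd k).
split=> //.
- apply/cvgrPdist_lt => e e0.
  apply: (bounded_near_clusters yM (U := [set x | `|0 - Phi P Q c x| < e])).
  move=> z /cluster_sol[_ rz].
  have /cvgrPdist_lt/(_ e e0) := @Phi_continuous _ _ _ P Q c z.
  have -> : Phi P Q c z = 0 by rewrite /Phi rz enorm0 expr0n mulr0.
  exact.
- apply: dist_cvg0 => e e0.
  apply: (bounded_near_clusters yM
    (U := [set x | exists2 z, sol_set P Q c z & enorm (x - z) < e])).
  move=> z /cluster_sol Sz.
  have cz : continuous
      (fun x : 'cV[R]_(n + n) => enorm (1%:M *m x + (- z)) ^+ 2).
    exact: continuous_enorm_sqr.
  have : \forall x \near z, enorm (1%:M *m x + (- z)) ^+ 2 < e ^+ 2.
    apply: (cvgr_lt _ (cz z)).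
    by rewrite mul1mx subrr enorm0 expr0n exprn_gt0.
  apply: filterS => x; rewrite mul1mx => xz; exists z => //.
  by rewrite -(ltr_pXn2r (n := 2)) // nnegrE ?enorm_ge0 // ltW.
Qed.
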